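(* Let $G$ be a finite group and let $T=F_2^*(G)$. Let $\epsilon>0$ and assume that $\Pr^*(T,G)\ge\epsilon$. Then the index $|G:F_2(G)|$ is $\epsilon$-bounded.
   Context: For subsets $X,Y$ of a finite group, $\Pr(X,Y)=\frac{|\{(x,y)\in X\times Y : xy=yx\}|}{|X||Y|}$. $\pi(X)$ denotes the set of primes dividing $|X|$, and $Syl_p(X)$ the set of Sylow $p$-subgroups of $X$. For subgroups $X,Y$ of a finite group $G$, $\Pr^*(X,Y)$ denotes the maximum real number $\epsilon$ such that for every pair of distinct primes $p\in\pi(X)$ and $q\in\pi(Y)$ there are $P\in Syl_p(X)$ and $Q\in Syl_q(Y)$ with $\Pr(P,Q)\ge\epsilon$; thus ''$\Pr^*(X,Y)\ge\epsilon$'' means that for every such pair of distinct primes there are such $P,Q$ with $\Pr(P,Q)\ge\epsilon$. $F(G)$ is the Fitting subgroup of $G$ and $F_2(G)$ is the full preimage in $G$ of $F(G/F(G))$. The generalized Fitting subgroup $F^*(G)$ is the product of $F(G)$ and all subnormal quasisimple subgroups of $G$, where a group is quasisimple if it is perfect and its quotient by its centre is a nonabelian simple group. $F_2^*(G)$ is the full preimage in $G$ of $F^*(G/F^*(G))$. ''$\epsilon$-bounded'' means bounded above by a number depending only on $\epsilon$. *)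

(* Defs.v *)
From HB Require Import structures.
From mathcomp Require Import all_boot all_order all_algebra.
From mathcomp Require Import all_fingroup all_solvable.
From mathcomp Require Import reals.

Set Implicit Arguments.
Unset Strict Implicit.
Unset Printing Implicit Defensive.

Import GroupScope.

Definition commuting_pairs (gT : finGroupType) (X Y : {set gT}) :
    {set gT * gT} :=
  [set xy in setX X Y | xy.1 * xy.2 == xy.2 * xy.1].

Definition comm_prob (R : realType) (gT : finGroupType) (X Y : {set gT}) : R :=
  (#|commuting_pairs X Y|%:R / (#|X|%:R * #|Y|%:R))%R.

(* Pr^*(X, Y) >= eps. Only this relation is defined: if there is no pair of
   distinct primes p, q as below, then every eps is admissible and there is no
   largest one. *)
Definition comm_prob_star_ge (R : realType) (gT : finGroupType)
    (X Y : {group gT}) (eps : R) : Prop :=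
  forall p q : nat, p \in \pi(X) -> q \in \pi(Y) -> p <> q ->
  exists P Q : {group gT},
    [/\ P \in 'Syl_p(X), Q \in 'Syl_q(Y) & (eps <= comm_prob R P Q)%R].

(* [simple] includes nontriviality, so the trivial group is not quasisimple. *)
Definition quasisimple (gT : finGroupType) (K : {group gT}) : bool :=
  [&& K^`(1) == K, simple (K / 'Z(K)) & ~~ abelian (K / 'Z(K))].

(* F^*(G). In the scope %G a product of groups is the subgroup generated by
   the factors; here it is also the set of products, since distinct subnormal
   quasisimple subgroups of G centralise each other and 'F(G). *)
Definition gen_Fitting (gT : finGroupType) (G : {group gT}) : {group gT} :=
  ('F(G) * \prod_(K : {group gT} | subnormal K G && quasisimple K) K)%G.

(* [@*^-1] is taken in the domain 'N('F(G)) of [coset 'F(G)]; as this contains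
   G, and 'F(G) \subset G, it is the full preimage in G. The same holds for
   [gen_Fitting2], which is F_2^*(G). *)
Definition Fitting2 (gT : finGroupType) (G : {group gT}) : {group gT} :=
  (coset 'F(G) @*^-1 'F(G / 'F(G)))%G.

Definition gen_Fitting2 (gT : finGroupType) (G : {group gT}) : {group gT} :=
  (coset (gen_Fitting G) @*^-1 gen_Fitting (G / gen_Fitting G))%G.

(* Main.v *)
(* Fix [k >= 1 / eps]; every bound below depends on [k] only.

   If [Pr(P, Q) >= eps], then [P] has a subgroup of bounded index whose elements
   centralise subgroups of bounded index of [Q], and conversely. If [q > (2 k)!]
   and [Q] is a Sylow [q]-subgroup of [G], it follows that [Q] has at most
   [(2 k)!] conjugates in [T Q], hence that [T] normalises [Q]. So
   [[T, Q] <= F(G)], which forces [Q <= T] because a generalised Fitting subgroup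
   contains its centraliser, and then [Q <= F(G)]. Therefore [X := G / F(G)] only
   involves bounded primes, and [N := T / F(G)] contains ['C_X(N)].

   A group [A] with ['F(A) = 1], only bounded primes and [Pr*(A, A) >= eps] has
   bounded order: a Sylow subgroup [P] has a subgroup [P1] of bounded index whose
   central elements have boundedly many conjugates in [A], and if [z] in ['Z(P1)]
   has the largest class, then ['C_A(z ^: A)], of bounded index, meets ['Z(P1)]
   and so [P1] trivially. Applied to [N / S], with [S] a maximal soluble subgroup
   of [N] normal in [X], this bounds [|N : S|]. Finally, by coprime action, a
   normal subgroup [D] of bounded index in [X] centralises [N / S] and acts on
   each ['O_p('F(S))] as a [p]-group; such a [D] is nilpotent, so it is contained
   in ['F(X)], and [|G : F_2(G)| = |X : 'F(X)|] is bounded. *)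
Require Import Defs.
From mathcomp Require Import all_boot all_order all_algebra.
From mathcomp Require Import all_fingroup all_solvable.
From mathcomp Require Import reals.
From mathcomp Require Import zify.

Set Implicit Arguments.
Unset Strict Implicit.
Unset Printing Implicit Defensive.

Import GroupScope.

(** * Counting commuting pairs *)

(** This is [Pr(P, Q) >= 1 / k] with denominators cleared, which keeps the counting in [nat]. *)
Definition almost_commute (gT : finGroupType) (k : nat) (P Q : {set gT}) :=
  (#|P| * #|Q| <= k * #|commuting_pairs P Q|)%N.

Lemma card_commuting_pairs (gT : finGroupType) (P Q : {set gT}) :
  #|commuting_pairs P Q| = (\sum_(x in P) #|'C_Q[x]|)%N.
Proof.
rewrite -sum1_card.
transitivity (\sum_(x in P) \sum_(y in 'C_Q[x]) 1)%N; last first.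
  by apply: eq_bigr => x _; rewrite sum1_card.
rewrite pair_big_dep /=; apply: eq_bigl => -[x y] /=.
by rewrite in_setI cent1E !inE /= -andbA eq_sym.
Qed.

Lemma card_commuting_pairsC (gT : finGroupType) (P Q : {set gT}) :
  #|commuting_pairs P Q| = #|commuting_pairs Q P|.
Proof.
have swapK : involutive (fun z : gT * gT => (z.2, z.1)) by case.
rewrite -(card_imset _ (inv_inj swapK)); apply: eq_card => -[x y].
rewrite -[(x, y)]/((fun z => (z.2, z.1)) (y, x)) (mem_imset _ _ (inv_inj swapK)).
by rewrite !inE /= eq_sym [(y \in P) && _]andbC.
Qed.

Lemma almost_commuteC (gT : finGroupType) k (P Q : {set gT}) :
  almost_commute k P Q = almost_commute k Q P.
Proof. by rewrite /almost_commute mulnC card_commuting_pairsC. Qed.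

(** For each [y] in [Q] the product set ['C_P[y] * P0] lies in [P], so the proportion of elements
    commuting with [y] is at least as large in [P0] as in [P]. *)
Lemma almost_commuteSl (gT : finGroupType) k (P0 P : {group gT})
    (Q : {set gT}) :
  P0 \subset P -> almost_commute k P Q -> almost_commute k P0 Q.
Proof.
rewrite /almost_commute => sP0P acPQ.
rewrite -(leq_pmul2l (cardG_gt0 P)) mulnCA (leq_trans (leq_mul (leqnn _) acPQ))//.
rewrite mulnCA [leqRHS]mulnCA leq_mul2l; apply/orP; right.
rewrite ![#|commuting_pairs _ Q|]card_commuting_pairsC !card_commuting_pairs.
rewrite !big_distrr /=; apply: leq_sum => y _.
rewrite mulnC mul_cardG setIAC (setIidPr sP0P) leq_mul2r.
by rewrite subset_leq_card ?orbT// mul_subG// subsetIl.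
Qed.

Lemma almost_commuteS (gT : finGroupType) k (P0 P Q0 Q : {group gT}) :
  P0 \subset P -> Q0 \subset Q ->
  almost_commute k P Q -> almost_commute k P0 Q0.
Proof.
move=> sP sQ acPQ; apply: almost_commuteSl sP _; rewrite almost_commuteC.
by apply: almost_commuteSl sQ _; rewrite almost_commuteC.
Qed.

Lemma almost_commuteJ (gT : finGroupType) k (P Q : {group gT}) x :
  almost_commute k (P :^ x) (Q :^ x) = almost_commute k P Q.
Proof.
rewrite /almost_commute !cardJg !card_commuting_pairs; congr (_ <= k * _)%N.
rewrite (reindex_inj (conjg_inj x)) /=; apply: eq_big => y.
  by rewrite memJ_conjg.
by move=> _; rewrite cent1J -conjIg cardJg.
Qed.

Lemma index_leP (gT : finGroupType) (G H : {group gT}) m :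
  H \subset G -> (#|G : H| <= m)%N = (#|G| <= m * #|H|)%N.
Proof.
by move=> sHG; rewrite -(Lagrange sHG) [in RHS]mulnC leq_pmul2r.
Qed.

Lemma sum_quotient (gT : finGroupType) (Q N : {group gT})
    (f : coset_of N -> nat) : Q \subset 'N(N) ->
  (\sum_(y in Q) f (coset N y) = #|N :&: Q| * \sum_(u in Q / N) f u)%N.
Proof.
move=> nQ; rewrite (partition_big_imset (coset N)) /= big_distrr /=.
have -> : [set coset N x | x in Q] = Q / N by rewrite /quotient morphimEsub.
apply: eq_bigr => u Qu.
have /morphimP[y Ny Qy def_u] := Qu.
rewrite (eq_bigr (fun=> f u)) => [|x /andP[_ /eqP->]//].
rewrite sum_nat_const; congr (_ * _)%N.
rewrite -(card_rcoset (N :&: Q) y); apply: eq_card => x; rewrite [LHS]unfold_in def_u.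
rewrite mem_rcoset in_setI (groupMr x (groupVr Qy)) [RHS]andbC.
case Qx: (x \in Q) => //=; have Nx := subsetP nQ x Qx.
apply/eqP/idP => [eqxy | Nxy].
  apply: coset_idr; first by rewrite groupM ?groupV.
  by rewrite morphM ?groupV// morphV//= eqxy mulgV.
by rewrite -[x](mulgKV y) morphM ?groupM ?groupV//= (coset_id Nxy) mul1g.
Qed.

(** The order of ['C_P[y]] is at most [#|N :&: P|] times that of the centraliser of [coset N y] in
    [P / N]; this is summed over the fibres of [coset N] on [Q]. *)
Lemma almost_commute_quotient (gT : finGroupType) k (P Q N : {group gT}) :
  P \subset 'N(N) -> Q \subset 'N(N) ->
  almost_commute k P Q -> almost_commute k (P / N) (Q / N).
Proof.
move=> nP nQ; rewrite /almost_commute.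
rewrite ![#|commuting_pairs P _|]card_commuting_pairsC.
rewrite ![#|commuting_pairs (P / N) _|]card_commuting_pairsC.
rewrite !card_commuting_pairs => ac.
have cardE (H : {group gT}) : H \subset 'N(N) ->
    #|H| = (#|N :&: H| * #|H / N|)%N.
  by move=> nH; rewrite card_quotient// setIC LagrangeI.
have cardP := cardE P nP; have cardQ := cardE Q nQ.
have le : (\sum_(y in Q) #|'C_P[y]|
   <= #|N :&: P| * (#|N :&: Q| * \sum_(u in Q / N) #|'C_(P / N)[u]|))%N.
  rewrite -sum_quotient// big_distrr /=; apply: leq_sum => y Qy.
  have sC : 'C_P[y] \subset 'N(N) by rewrite (subset_trans _ nP)// subsetIl.
  rewrite (cardE _ sC).
  apply: leq_mul; first by rewrite subset_leq_card// setIS// subsetIl.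
  by rewrite subset_leq_card// quotient_subcent1.
move: ac; rewrite cardP cardQ => ac.
have a0 := cardG_gt0 (N :&: P); have b0 := cardG_gt0 (N :&: Q).
rewrite -(leq_pmul2l a0) -(leq_pmul2l b0).
have := leq_trans ac (leq_mul (leqnn k) le); set S := (\sum_(u in _) _)%N.
by rewrite mulnACA (mulnCA k) (mulnCA k) -mulnA
  ![(#|N :&: P| * (#|N :&: Q| * _))%N]mulnCA.
Qed.

(** Averaging: the elements [x] with [#|Q : 'C_Q[x]| > 2 * k] account for at most half of the
    [#|P| * #|Q| / k] commuting pairs that must exist. *)
Lemma almost_commute_density (gT : finGroupType) k (P Q : {group gT}) :
  almost_commute k P Q ->
  (#|P| <= 2 * k * #|[set x in P | #|Q : 'C_Q[x]| <= 2 * k]|)%N.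
Proof.
rewrite /almost_commute card_commuting_pairs => ac.
set S := [set x in P | _].
have bnd x : (2 * k * #|'C_Q[x]| <=
    (if #|Q : 'C_Q[x]| <= 2 * k then 2 * k * #|Q| else #|Q|))%N.
  case: ifP => [_ | /negbT]; first by rewrite leq_mul2l subset_leq_card ?orbT ?subsetIl.
  rewrite -ltnNge => /ltnW lt.
  by rewrite -(Lagrange (subsetIl Q 'C[x])) mulnC leq_mul2l lt orbT.
have : (2 * (#|P| * #|Q|) <= 2 * k * #|Q| * #|S| + #|Q| * #|P|)%N.
  apply: leq_trans (_ : 2 * (k * \sum_(x in P) #|'C_Q[x]|) <= _)%N.
    by rewrite leq_mul2l ac.
  rewrite mulnA big_distrr /=.
  apply: leq_trans; first by apply: leq_sum => x _; apply: bnd.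
  rewrite (bigID (fun x => #|Q : 'C_Q[x]| <= 2 * k)%N) /=.
  rewrite (eq_bigr (fun=> 2 * k * #|Q|)%N) => [|x /andP[_ ->]//].
  rewrite [X in (_ + X)%N](eq_bigr (fun=> #|Q|)) => [|x /andP[_ /negPf->]//].
  rewrite leq_add//; last first.
    rewrite sum_nat_const mulnC leq_mul2l; apply/orP; right.
    by apply/subset_leq_card/subsetP => x; rewrite unfold_in => /andP[].
  rewrite sum_nat_const mulnC leq_mul2l; apply/orP; right.
  by rewrite subset_leq_card//; apply/subsetP => x; rewrite !inE.
have := cardG_gt0 Q; nia.
Qed.

(** * Indices *)

Lemma index_setI (gT : finGroupType) (G H K : {group gT}) :
  (#|G : H :&: K| <= #|G : H| * #|G : K|)%N.
Proof.
rewrite -(leq_pmul2l (cardG_gt0 (G :&: (H :&: K)))) LagrangeI.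
rewrite -(leq_pmul2l (cardG_gt0 G)) mulnA.
rewrite -{1}(LagrangeI G H) -{1}(LagrangeI G K) mulnACA leq_mul2r.
apply/orP; right.
rewrite [leqLHS]mul_cardG /= -setIIr leq_mul2r.
by rewrite subset_leq_card ?orbT// mul_subG ?subsetIl.
Qed.

Lemma index_bigcap (gT : finGroupType) (I : finType) (P : pred I)
    (G : {group gT}) (F : I -> {group gT}) m :
    (forall i, P i -> (#|G : F i| <= m)%N) ->
  (#|G : \bigcap_(i | P i) F i| <= m ^ #|P|)%N.
Proof.
move=> leF; rewrite -big_filter cardE -[filter P _]/(enum P).
have : all P (enum P) by apply/allP => i; rewrite mem_enum.
(* The existential makes each partial intersection a group, as [index_setI] requires. *)
suff IH r : all P r -> exists2 K : {group gT},
    \bigcap_(i <- r) F i = K & (#|G : K| <= m ^ size r)%N.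
  by case/IH=> K ->.
elim: r => [_|i r IH /= /andP[Pi /IH[K defK leK]]].
  by exists [set: gT]%G; rewrite ?big_nil // -indexgI setIT indexgg.
exists (F i :&: K)%G; first by rewrite big_cons defK.
by rewrite expnS (leq_trans (index_setI _ _ _))// leq_mul// leF.
Qed.

Lemma index_cent (gT : finGroupType) (G : {group gT}) (A : {set gT}) m :
    (forall a, a \in A -> (#|G : 'C_G[a]| <= m)%N) ->
  (#|G : 'C_G(A)| <= m ^ #|A|)%N.
Proof.
move=> leA; rewrite indexgI.
rewrite /=; have -> : 'C(A) = \bigcap_(a in A) 'C[a].
  apply/setP=> x; apply/centP/bigcapP => cAx a Aa;
  exact/cent1P/cAx.
apply: (@index_bigcap _ _ (mem A) G (fun a => 'C[a]%G)) => a Aa.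
by rewrite -indexgI leA.
Qed.

(** As [#|Q :&: H|] is at most the [q]-part of [#|H|], the [q]-part of [#|G : H|] is at most [c] and
    so divides [c]![. Hence the whole index divides]c[!]. *)
Lemma index_leq_fact (gT : finGroupType) (G H : {group gT}) c :
    H \subset G ->
    (forall q, q \in \pi(G) ->
       exists2 Q : {group gT}, q.-Sylow(G) Q & (#|Q : H| <= c)%N) ->
  (#|G : H| <= c`!)%N.
Proof.
move=> sHG syl; rewrite dvdn_leq ?fact_gt0//.
apply/dvdn_partP => [|q]; first exact: indexg_gt0.
rewrite mem_primes => /and3P[pr_q _ q_dv].
have piGq : q \in \pi(G).
  by rewrite mem_primes pr_q cardG_gt0 (dvdn_trans q_dv) ?dvdn_indexg.
have [Q sylQ leQ] := syl q piGq.
rewrite dvdn_fact// part_gt0 (leq_trans _ leQ)//.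
have qQ : q.-group (Q :&: H).
  by rewrite (pgroupS (subsetIl _ _))// (pHall_pgroup sylQ).
have dv : #|Q :&: H| %| #|H|`_q.
  by rewrite -(part_pnat_id qQ) partn_dvd ?cardSg ?subsetIr.
have := LagrangeI Q H; rewrite (card_Hall sylQ) -(Lagrange sHG) partnM//.
have := dvdn_leq (part_gt0 _ _) dv.
have := cardG_gt0 (Q :&: H); have := part_gt0 q #|H|.
move: #|Q :&: H| #|Q : H| (#|H|`_q)%N (#|G : H|`_q)%N => a b e d.
nia.
Qed.

(** * Boundedly many conjugates *)

Lemma index_cent1M (gT : finGroupType) (Q : {group gT}) (x y : gT) :
  (#|Q : 'C[x * y]| <= #|Q : 'C[x]| * #|Q : 'C[y]|)%N.
Proof.
apply: leq_trans (index_setI _ _ _).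
rewrite dvdn_leq ?indexg_gt0// indexgS//; apply/subsetP=> z /setIP[cxz cyz].
by rewrite cent1C groupM // cent1C.
Qed.

Lemma index_cent1V (gT : finGroupType) (Q : {group gT}) (x : gT) :
  #|Q : 'C[x^-1]| = #|Q : 'C[x]|.
Proof.
by congr #|_ : _|; rewrite -(cent_cycle x^-1) cycleV cent_cycle.
Qed.

(** The square pays for a product of two elements with at most [bound_seq k j * (2 * k)] conjugates,
    the last factor for multiplying it by an element with at most [2 * k]. *)
Fixpoint bound_seq k j : nat :=
  if j is j'.+1 then (bound_seq k j' * (2 * k)) ^ 2 * (2 * k) else 2 * k.

Definition class_bound k : nat := \max_(j < 2 * k) (bound_seq k j * (2 * k))%N.

(* The sets [S m] of elements with at most [m] [Q]-conjugates satisfy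
   [S m * S n \subset S (m * n)]; one of the sets [S (bound_seq k j * (2 * k))]
   with [j < 2 * k] is a subgroup, as otherwise each [S (bound_seq k j.+1)]
   contains [S (bound_seq k j)] and a disjoint translate of [S (2 * k)]. *)
Lemma bounded_class_subgroup (gT : finGroupType) k (P Q : {group gT}) :
    0 < k -> almost_commute k P Q ->
  exists P0 : {group gT}, [/\ P0 \subset P, (#|P : P0| <= 2 * k)%N
    & forall x, x \in P0 -> (#|Q : 'C[x]| <= class_bound k)%N].
Proof.
move=> k0 /almost_commute_density.
pose S m := [set x in P | #|Q : 'C[x]| <= m].
have SP m x : (x \in S m) = (x \in P) && (#|Q : 'C[x]| <= m) by rewrite inE.
have -> : [set x in P | #|Q : 'C_Q[x]| <= 2 * k] = S (2 * k)%N.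
  by apply/setP=> x; rewrite !inE indexgI.
move=> dens.
have SM m n x y : x \in S m -> y \in S n -> x * y \in S (m * n)%N.
  rewrite !SP => /andP[Px xm] /andP[Py yn]; rewrite groupM//=.
  by rewrite (leq_trans (index_cent1M _ _ _))// leq_mul.
have SV m x : x \in S m -> x^-1 \in S m by rewrite !SP groupV index_cent1V.
have SS m n : m <= n -> S m \subset S n.
  by move=> mn; apply/subsetP=> x; rewrite !SP => /andP[-> /leq_trans->].
have kk0 : 0 < 2 * k by rewrite muln_gt0.
have w0 j : 2 * k <= bound_seq k j.
  elim: j => [|j IH] //=; rewrite leq_pmull// expn_gt0 muln_gt0 kk0.
  by rewrite (leq_trans kk0 IH).
suff [j lt2k grj] : exists2 j, j < 2 * k & group_set (S (bound_seq k j * (2 * k))%N).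
  exists (Group grj); split.
  - by apply/subsetP=> x; rewrite SP => /andP[].
  - rewrite index_leP /=; last by apply/subsetP=> x; rewrite SP => /andP[].
    rewrite (leq_trans dens)// leq_mul2l subset_leq_card ?orbT// SS//.
    by rewrite leq_pmull// (leq_trans kk0 (w0 j)).
  - move=> x; rewrite SP => /andP[_ /leq_trans]; apply.
    exact: (leq_bigmax (Ordinal lt2k)).
have step j : ~~ group_set (S (bound_seq k j * (2 * k))%N) ->
    #|S (bound_seq k j)| + #|S (2 * k)%N| <= #|S (bound_seq k j.+1)|.
  set m := (bound_seq k j * (2 * k))%N => ngr.
  have [x Smx Sx] : exists2 x, x \in S (m * m)%N & x \notin S m.
    move: ngr; rewrite /group_set; have -> : 1 \in S m.
      rewrite SP group1 cent11T -indexgI setIT indexgg /= muln_gt0 kk0 andbT.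
      exact: leq_trans (w0 j).
    by case/subsetPn=> _ /mulsgP[y z Sy Sz ->] Syz; exists (y * z) => //; apply: SM.
  have dis : [disjoint S (bound_seq k j) & x *: S (2 * k)%N].
    rewrite disjoint_subset; apply/subsetP=> y Sy; rewrite inE.
    apply: contra Sx => /lcosetP[s Ss def_y]; rewrite -(mulgK s x) -def_y.
    by rewrite SM ?SV.
  rewrite -(card_lcoset (S (2 * k)%N) x).
  move: dis; rewrite -leq_card_setU => /eqP<-.
  rewrite subset_leq_card// subUset; apply/andP; split.
    have w_gt0 := leq_trans kk0 (w0 j).
    by rewrite SS//= -mulnn -2!mulnA leq_pmulr// !(muln_gt0, w_gt0, k0).
  by apply/subsetP=> _ /lcosetP[s Ss ->] /=; rewrite -mulnn SM.
have [/existsP[j grj] | ] := boolP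
    [exists j : 'I_(2 * k), group_set (S (bound_seq k j * (2 * k))%N)].
  by exists j.
rewrite negb_exists => /forallP none.
(* Each step adds at least [#|P| / (2 * k)] elements, so after [2 * k] steps the set would be larger
   than [P]. *)
have grow j : j <= 2 * k -> j.+1 * #|P| <= 2 * k * #|S (bound_seq k j)|.
  elim: j => [|j IH] ltj; first by rewrite mul1n.
  have := leq_mul (leqnn (2 * k)) (step j (none (Ordinal ltj))).
  by apply: leq_trans; rewrite mulnDr mulSn addnC leq_add// IH// ltnW.
have := grow _ (leqnn _); have : #|S (bound_seq k (2 * k))| <= #|P|.
  by rewrite subset_leq_card//; apply/subsetP=> x; rewrite SP => /andP[].
have := cardG_gt0 P; move: #|P| #|S _| => a b; nia.
Qed.

(** The index [#|P : 'C_P[y]|] is a power of [p], so it is [1] as soon as it is at most [2 * k]; the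
    elements counted by [almost_commute_density] then centralise [P]. *)
Lemma large_prime_almost_commute (gT : finGroupType) k (p : nat)
    (P Q : {group gT}) :
  p.-group P -> 2 * k < p -> almost_commute k P Q -> #|Q : 'C(P)| <= 2 * k.
Proof.
move=> pP ltp; rewrite almost_commuteC -indexgI => /almost_commute_density dens.
rewrite index_leP ?subsetIl// (leq_trans dens)// leq_mul2l.
rewrite subset_leq_card ?orbT//; apply/subsetP=> y; rewrite inE => /andP[Qy].
move=> ley; rewrite inE Qy /=; suff : P \subset 'C[y] by rewrite sub_cent1.
rewrite -indexg_eq1 -indexgI; apply: contraTT ley; rewrite -ltnNge => ne1.
have [m def_m] := p_natP (pnat_dvd (dvdn_indexg P 'C_P[y]) pP).
move: ne1; rewrite def_m; case: m def_m => // m _ _.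
by rewrite (leq_trans ltp)// expnS leq_pmulr// expn_gt0 (leq_trans _ ltp).
Qed.

(** * Coprime action *)

Lemma leq_indexl (gT : finGroupType) (R Q : {group gT}) (H : {set gT}) :
  R \subset Q -> #|R : H| <= #|Q : H|.
Proof. by move=> sRQ; rewrite subset_leq_card// imsetS. Qed.

Lemma leq_index_trans (gT : finGroupType) (H R Q : {group gT}) :
  R \subset Q -> #|Q : H| <= #|Q : R| * #|R : H|.
Proof.
move=> sRQ; rewrite -(indexgI R) Lagrange_index ?subsetIl//.
by rewrite dvdn_leq ?indexg_gt0// indexgS// subsetIr.
Qed.

Lemma conjg_mul_fixed (gT : finGroupType) (u d y : gT) n :
  d ^ y = d -> u ^ y = u * d -> u ^ (y ^+ n) = u * d ^+ n.
Proof.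
move=> dy uy; elim: n => [|n IH]; first by rewrite conjg1 mulg1.
by rewrite expgSr conjgM IH conjMg conjXg dy uy -mulgA -expgS.
Qed.

(** Conjugating [u] by [y] as often as the order of [y] gives [u = u * d ^+ #[y]]; so [#[d]] divides
    both [#|P|] and [#|Q|], and [d = 1]. *)
Lemma coprime_conjg_fixed (gT : finGroupType) (P Q : {group gT}) u d y :
    coprime #|P| #|Q| -> d \in P -> y \in Q ->
  d ^ y = d -> u ^ y = u * d -> u ^ y = u.
Proof.
move=> coPQ Pd Qy dy uy; have := conjg_mul_fixed #[y] dy uy.
rewrite expg_order conjg1 -[u in u = _]mulg1 => /mulgI/esym d1.
have : #[d] %| gcdn #|P| #|Q|.
  rewrite dvdn_gcd order_dvdG//= (dvdn_trans _ (order_dvdG Qy))//.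
  by rewrite order_dvdn d1.
by rewrite (eqP coPQ) dvdn1 order_eq1 uy => /eqP->; rewrite mulg1.
Qed.

(** Supplies so few conjugating elements that their common centraliser has bounded index. *)
Lemma class_section (gT : finGroupType) (R : {group gT}) (x : gT) :
  exists Y : {set gT}, [/\ Y \subset R, #|Y| <= #|x ^: R|
    & forall z, z \in x ^: R -> exists2 y, y \in Y & z = x ^ y].
Proof.
pose r z := odflt 1 [pick y in R | z == x ^ y].
have rP z : z \in x ^: R -> r z \in R /\ z = x ^ r z.
  rewrite /r => /imsetP[y Ry def_z]; case: pickP => [w /andP[Rw /eqP]//|].
  by move/(_ y); rewrite Ry def_z eqxx.
exists (r @: (x ^: R)); rewrite leq_imset_card; split=> // [|z xz].
  by apply/subsetP=> _ /imsetP[z /rP[Rr _] ->].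
by exists (r z); [apply: imset_f | case: (rP z xz)].
Qed.

(** In the proof below [b] bounds [#|P : U|], and [2 * k], [m ^ m], [b ^ b] bound the successive
    indices in the chain [Q], [R], [R1], [R1 :&: W]. *)
Definition coprime_bound k : nat :=
  let m := class_bound k in let b := (2 * k * m ^ m)%N in
  (2 * k * (m ^ m * b ^ b))%N.

(* If [x] in [P0] has the largest class under [R] and [u] in [P0] commutes with
   representatives for [x ^: R], then [(u * x) ^: R = u *: x ^: R]; hence
   [[u, y]] is a quotient of elements of [x ^: R] for all [y] in ['C_R[x]]. If
   [y] centralises [x ^: R], it fixes [[u, y]], which is then [1] by coprimality. *)
Lemma coprime_almost_commute (gT : finGroupType) k (P Q : {group gT}) :
    0 < k -> coprime #|P| #|Q| -> Q \subset 'N(P) -> almost_commute k P Q ->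
  #|Q : 'C(P)| <= coprime_bound k.
Proof.
move=> k0 coPQ nPQ acPQ; rewrite /coprime_bound.
set m := class_bound k; set b := (2 * k * m ^ m)%N.
have [P0 [sP0 leP0 P0m]] := bounded_class_subgroup k0 acPQ.
rewrite almost_commuteC in acPQ.
have [R [sR leR Rm]] := bounded_class_subgroup k0 acPQ.
have coPR : coprime #|P| #|R| := coprimegS sR coPQ.
have nPR := subset_trans sR nPQ.
have m0 : 0 < m by apply: leq_trans (P0m 1 (group1 _)); apply: indexg_gt0.
have classm x : x \in P0 -> #|x ^: R| <= m.
  move=> P0x; rewrite -index_cent1 indexgI.
  exact: leq_trans (leq_indexl _ sR) (P0m x P0x).
have [x P0x max_x] := arg_maxnP (fun x => #|x ^: R|) (group1 P0).
have [Y [sY leY Yx]] := class_section R x.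
set D := x ^: R in leY Yx.
have maxD z : z \in P0 -> #|z ^: R| <= #|D| := max_x z.
have leDm : #|D| <= m by apply: classm.
pose U := (P0 :&: 'C(Y))%G.
have leU : #|P : U| <= b.
  rewrite (leq_trans (index_setI _ _ _))// leq_mul// -indexgI.
  apply: leq_trans (_ : m ^ #|Y| <= _)%N; last first.
    by rewrite leq_pexp2l// (leq_trans leY).
  by apply: index_cent => y Yy; rewrite indexgI Rm// (subsetP sY).
pose R1 := (R :&: 'C(D))%G.
have leR1 : #|R : R1| <= m ^ m.
  rewrite indexgI; apply: leq_trans (_ : m ^ #|D| <= _); last first.
    by rewrite leq_pexp2l.
  rewrite -indexgI; apply: index_cent => z Dz.
  by rewrite index_cent1; have <- : D = z ^: R by apply/esym/class_eqP.
have sUP : U \subset P by apply: subset_trans sP0; apply: subsetIl.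
have cUR1 : R1 \subset 'C(U).
  apply/centsP=> y /setIP[Ry cDy] u Uu; apply/commute_sym/commgP/conjg_fixP.
  have [[P0u cYu] cxy] := (setIP Uu, commute_sym (centP cDy x (class_refl R x))).
  have defD : u *: D = (u * x) ^: R.
    apply/eqP; rewrite eqEcard card_lcoset maxD ?groupM// andbT.
    apply/subsetP=> _ /lcosetP[z /Yx[w Yw ->] ->].
    apply/imsetP; exists w; first exact: (subsetP sY).
    rewrite conjMg; congr (_ * _); apply/esym/conjg_fixP/commgP.
    exact: (centP cYu).
  have : (u * x) ^ y \in u *: D by rewrite defD memJ_class.
  have xy : x ^ y = x by apply/conjg_fixP/commgP.
  case/lcosetP=> z Dz; rewrite conjMg xy.
  move/(canRL (mulgK x)); rewrite -mulgA => uy.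
  have Px := subsetP sP0 x P0x.
  have Pz : z \in P by have /imsetP[w Rw ->] := Dz; rewrite memJ_norm ?(subsetP nPR).
  apply: (coprime_conjg_fixed coPR _ Ry _ uy); first by rewrite groupM ?groupV.
  rewrite conjMg conjVg; congr (_ * _^-1); apply/conjg_fixP/commgP => //.
  by apply/commute_sym/(centP cDy).
have nUR1 : R1 \subset 'N(U) by apply: cents_norm.
(* [R1] permutes the at most [b] cosets of [U] in [P]. An element fixing all of them sends [t] to
   some [t * u] with [u] in [U]; it centralises [u], hence fixes [t] by coprimality. *)
pose W := bigcap_group (mem (lcosets U P)) (fun A => 'N(A)%G).
have leR2 : #|R1 : W| <= b ^ b.
  have leLb : #|lcosets U P| <= b by rewrite card_lcosets.
  apply: leq_trans (_ : b ^ #|lcosets U P| <= _)%N; last first.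
    by rewrite leq_pexp2l// (leq_trans _ leU)// indexg_gt0.
  apply: (@index_bigcap _ _ (mem (lcosets U P)) R1 (fun A => 'N(A)%G)) => A LA.
  rewrite /= -astab1Js -indexgI -card_orbit (leq_trans _ leLb)// subset_leq_card//.
  apply/subsetP=> _ /orbitP[y R1y <-] /=.
  have /lcosetsP[t Pt ->] := LA.
  have /setIP[Ry _] := R1y; rewrite conjsMg conjg_set1 (normP (subsetP nUR1 y R1y)).
  by apply/lcosetsP; exists (t ^ y); rewrite ?memJ_norm// (subsetP nPR).
have cR2 : R1 :&: W \subset 'C(P).
  apply/centsP=> y /setIP[R1y /bigcapP Wy] t Pt; apply/commute_sym/commgP/conjg_fixP.
  have /lcosetP[u Uu ty] : t ^ y \in t *: U.
    by rewrite memJ_norm ?lcoset_refl// Wy//; apply/lcosetsP; exists t.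
  apply: (coprime_conjg_fixed coPR (subsetP sUP u Uu) _ _ ty).
    by case/setIP: R1y.
  by apply/conjg_fixP/commgP/commute_sym/(centsP cUR1).
rewrite (leq_trans (leq_index_trans _ sR))// leq_mul//.
rewrite (leq_trans (leq_index_trans _ (subsetIl R 'C(D))))// leq_mul//.
apply: leq_trans leR2; rewrite -(indexgI _ W).
by rewrite dvdn_leq ?indexg_gt0// indexgS.
Qed.

(** * Groups with trivial Fitting subgroup *)

Definition sylow_almost_commute (k : nat) (gT : finGroupType)
    (X Y : {group gT}) :=
  forall p q : nat, p \in \pi(X) -> q \in \pi(Y) -> p <> q ->
  exists P Q : {group gT},
    [/\ p.-Sylow(X) P, q.-Sylow(Y) Q & almost_commute k P Q].

Section SylowAlmostCommute.

Variables (k : nat) (gT : finGroupType) (X Y : {group gT}).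
Hypothesis acXY : sylow_almost_commute k X Y.

(** Conjugating the given pair by an element of [X] lets [P] be prescribed. To prescribe [Q] the
    conjugating element is in [Y], so the next lemma takes [X] normal in [Y]. *)
Lemma sylow_almost_commute_l (p q : nat) (P : {group gT}) :
    X \subset Y -> p.-Sylow(X) P -> p \in \pi(X) -> q \in \pi(Y) -> p <> q ->
  exists2 Q : {group gT}, q.-Sylow(Y) Q & almost_commute k P Q.
Proof.
move=> sXY sylP piXp piYq neq_pq.
have [P1 [Q [sylP1 sylQ ac]]] := acXY piXp piYq neq_pq.
have [x Xx def_P] := Sylow_trans sylP1 sylP.
exists (Q :^ x)%G; last by rewrite def_P almost_commuteJ.
by rewrite pHallJ// (subsetP sXY).
Qed.

Lemma sylow_almost_commute_r (p q : nat) (Q : {group gT}) :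
    X <| Y -> q.-Sylow(Y) Q -> p \in \pi(X) -> q \in \pi(Y) -> p <> q ->
  exists2 P : {group gT}, p.-Sylow(X) P & almost_commute k P Q.
Proof.
move=> /andP[_ nXY] sylQ piXp piYq neq_pq.
have [P [Q1 [sylP sylQ1 ac]]] := acXY piXp piYq neq_pq.
have [y Yy def_Q] := Sylow_trans sylQ1 sylQ.
exists (P :^ y)%G; last by rewrite def_Q almost_commuteJ.
by rewrite -(normsP nXY y Yy) pHallJ2.
Qed.

Lemma sylow_almost_commuteS (X0 Y0 : {group gT}) :
  X0 <| X -> Y0 <| Y -> sylow_almost_commute k X0 Y0.
Proof.
move=> nX nY p q piXp piYq neq_pq.
have [||P [Q [sylP sylQ ac]]] := acXY _ _ neq_pq.
- exact: piSg (normal_sub nX) _ piXp.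
- exact: piSg (normal_sub nY) _ piYq.
exists (P :&: X0)%G, (Q :&: Y0)%G.
split; [exact: Hall_setI_normal nX sylP | exact: Hall_setI_normal nY sylQ |].
exact: almost_commuteS (subsetIl _ _) (subsetIl _ _) ac.
Qed.

Lemma sylow_almost_commute_quotient (N : {group gT}) :
    X \subset 'N(N) -> Y \subset 'N(N) ->
  sylow_almost_commute k (X / N) (Y / N).
Proof.
move=> nX nY p q piXp piYq neq_pq.
have [||P [Q [sylP sylQ ac]]] := acXY _ _ neq_pq.
- exact: (pi_of_dvd (dvdn_quotient _ _)) piXp.
- exact: (pi_of_dvd (dvdn_quotient _ _)) piYq.
have nP := subset_trans (pHall_sub sylP) nX.
have nQ := subset_trans (pHall_sub sylQ) nY.
by exists (P / N)%G, (Q / N)%G; rewrite !quotient_pHall ?almost_commute_quotient.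
Qed.

End SylowAlmostCommute.

(** In [card_fitting_free], [a] bounds [#|P : P1|], [m] bounds the [A]-classes of elements of
    ['Z(P1)], and [m ^ m] bounds [#|A : K|] and so [#|P1|]. Both factorials come from
    [index_leq_fact]. *)
Definition fitting_free_bound k C : nat :=
  let a := ((2 * k) ^ C.+1)%N in let m := (maxn (class_bound k) a)`! in
  (a * m ^ m)`!.

(* Let [w] commute with all conjugates of [z]. As the normal closure [N] of [z]
   has trivial centre, it meets its centraliser trivially, so that
   [C_A(z w) = C_A(z) :&: C_A(w)]. *)
Lemma center_max_class (gT : finGroupType) (A Z : {group gT}) z :
    'F(A) = 1 -> Z \subset A -> z \in Z ->
    (forall w, w \in Z -> #|w ^: A| <= #|z ^: A|) ->
  Z :&: 'C(z ^: A) = 1.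
Proof.
move=> FA1 sZA Zz max_z; apply/trivgP/subsetP=> w /setIP[Zw Cw].
have Az := subsetP sZA z Zz; have Aw := subsetP sZA w Zw.
have abel1 (K : {group gT}) : K <| A -> abelian K -> K :=: 1.
  move=> nK cK; apply/trivgP; rewrite -FA1 Fitting_max//.
  exact: abelian_nil.
have nclos v : v \in A -> <<v ^: A>> <| A.
  move=> Av; rewrite /normal gen_subG class_subG//=.
  by rewrite norms_gen// class_norm.
have Z1 (K : {group gT}) : K <| A -> 'Z(K) = 1.
  by move=> nK; apply: abel1 (center_abelian K); apply: gFnormal_trans.
have nCA : A \subset 'N('C(z ^: A)) by rewrite norms_cent// class_norm.
have CC : 'C_A[z * w] \subset 'C_A[z].
  apply/subsetP=> a /setIP[Aa /cent1P cazw]; rewrite inE Aa /=.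
  apply/cent1P/commute_sym/commgP/conjg_fixP/eqP; rewrite eq_sym eq_mulVg1.
  have def : z^-1 * z ^ a = w * (w ^ a)^-1.
    apply: (mulIg (w ^ a)); rewrite mulgKV -mulgA -conjMg.
    by rewrite conjgE -cazw mulKg mulKg.
  have : z^-1 * z ^ a \in 'Z(<<z ^: A>>).
    rewrite inE; apply/andP; split.
      by rewrite groupM ?groupV// mem_gen ?class_refl ?memJ_class.
    by rewrite cent_gen def groupM ?groupV// memJ_norm ?(subsetP nCA).
  by rewrite (Z1 <<z ^: A>>%G) ?nclos// => /set1gP->.
have eqC : 'C_A[z * w] = 'C_A[z].
  apply/eqP; rewrite eqEcard CC/=.
  have := max_z _ (groupM Zz Zw); rewrite -!index_cent1.
  rewrite -(leq_pmul2l (cardG_gt0 'C_A[z])) Lagrange ?subsetIl//.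
  rewrite -(Lagrange (subsetIl A 'C[z * w])) leq_pmul2r//.
(* By maximality of the class of [z], ['C_A[z]] centralises [z * w] and so [w]. The conjugates of
   [w] lie in ['C(z ^: A)], so they commute with [w], which is then central in its normal closure
   and hence trivial. *)
have sCw : 'C(z ^: A) :&: A \subset 'C[w].
  apply/subsetP=> a /setIP[Ca Aa].
  have caz : a \in 'C[z] by apply/cent1P/(centP Ca)/class_refl.
  have /setIP[_ cazw] : a \in 'C_A[z * w] by rewrite eqC inE Aa.
  by rewrite -[w](mulKg z) cent1C groupM ?groupV// cent1C.
have : w \in 'Z(<<w ^: A>>).
  rewrite inE mem_gen ?class_refl// cent_gen; apply/centP=> _ /imsetP[a Aa ->].
  apply/cent1P; rewrite cent1C; apply: (subsetP sCw).
  by apply/setIP; rewrite (groupJ Aw Aa) memJ_norm ?(subsetP nCA).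
by rewrite (Z1 <<w ^: A>>%G) ?nclos.
Qed.

Lemma card_fitting_free k C (gT : finGroupType) (A : {group gT}) :
    0 < k -> 'F(A) = 1 -> {in \pi(A), forall q, q <= C} ->
    sylow_almost_commute k A A ->
  #|A| <= fitting_free_bound k C.
Proof.
move=> k0 FA1 leC acA; rewrite /fitting_free_bound.
set a := ((2 * k) ^ C.+1)%N; set c := maxn _ _; set m := c`!.
rewrite -indexg1; apply: index_leq_fact (sub1G A) _ => p piAp.
have [P sylP] := Sylow_exists p A; exists P => //; rewrite indexg1.
have sPA := pHall_sub sylP.
(* The indices [0, ..., C] include every prime in [\pi(A)]; at [p] and at the others [F := P] is a
   placeholder. *)
have ex_F (i : 'I_C.+1) : exists F : {group gT}, [/\ F \subset P, #|P : F| <= 2 * k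
    & (i : nat) \in \pi(A) -> p <> i -> exists2 Q : {group gT}, i.-Sylow(A) Q &
        forall x, x \in F -> #|Q : 'C[x]| <= class_bound k].
  have [/andP[piAi /eqP neq_pi] | bad] := boolP ((val i \in \pi(A)) && (p != i)).
    have [Q sylQ ac] := sylow_almost_commute_l acA (subxx A) sylP piAp piAi neq_pi.
    have [F [sFP leF Fm]] := bounded_class_subgroup k0 ac.
    by exists F; split=> // _ _; exists Q.
  exists P; split=> // [|piAi neq_pi]; first by rewrite indexgg muln_gt0.
  by case/andP: bad; split=> //; apply/eqP.
have [F FP] := fin_all_exists ex_F.
pose P1 := (P :&: bigcap_group predT F)%G.
have leP1 : #|P : P1| <= a.
  have cardC : #|{: 'I_C.+1}| = C.+1 := card_ord _.
  by rewrite indexgI /a -[in leqRHS]cardC; apply: index_bigcap => i _; have [] := FP i.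
have sP1P : P1 \subset P := subsetIl _ _.
have sZP1 : 'Z(P1) \subset P1 := subsetIl _ _.
(* At the prime [p], [z] is centralised by [P1]; at another prime [q], [z] lies in [F q] and has a
   bounded class under a Sylow [q]-subgroup. *)
have classm z : z \in 'Z(P1) -> #|z ^: A| <= m.
  move=> Zz; rewrite -index_cent1 index_leq_fact ?subsetIl// => q piAq.
  have [<- | /eqP neq_pq] := eqVneq p q.
    exists P => //; rewrite (leq_trans _ (leq_maxr _ _))// (leq_trans _ leP1)//.
    rewrite dvdn_leq// indexgS// subsetI (subset_trans sP1P)//= sub_cent1.
    by case/setIP: Zz.
  have [_ _ ] := FP (Ordinal (leC q piAq : q < C.+1)).
  case=> // Q sylQ Qm; exists Q => //; rewrite (leq_trans _ (leq_maxl _ _))//.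
  rewrite -indexgI setIA (setIidPl (pHall_sub sylQ)) indexgI Qm//.
  by have /setIP[/setIP[_ /bigcapP Fz] _] := Zz; apply: Fz.
have [z Zz max_z] := arg_maxnP (fun z => #|z ^: A|) (group1 'Z(P1)).
have sZA : 'Z(P1) \subset A by rewrite (subset_trans sZP1) ?(subset_trans sP1P).
have ZC1 := center_max_class FA1 sZA Zz max_z.
pose K := 'C(z ^: A).
have leK : #|A : K| <= m ^ m.
  rewrite -indexgI; apply: leq_trans (_ : m ^ #|z ^: A| <= _); last first.
    by rewrite leq_pexp2l ?fact_gt0// classm.
  apply: index_cent => y zAy; rewrite index_cent1.
  by have -> : y ^: A = z ^: A by [apply/class_eqP]; apply: classm.
have nKA : A \subset 'N(K) by rewrite norms_cent// class_norm.
have PK1 : P1 :&: K = 1.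
  apply/eqP; apply: contraT => nt; have pP1 := pgroupS sP1P (pHall_pgroup sylP).
  have := meet_center_nil (pgroup_nil pP1) _ nt; rewrite setIAC => /(_ _)/negP[].
    rewrite /normal subsetIl /= normsI ?normG//.
    by rewrite (subset_trans _ nKA) ?(subset_trans sP1P).
  by rewrite (setIidPr sZP1) ZC1.
rewrite -(Lagrange sP1P) mulnC leq_mul// -indexg1 -PK1 indexgI.
by rewrite (leq_trans _ leK)// leq_indexl// (subset_trans sP1P).
Qed.

(** * Nilpotent normal subgroups *)

(** Nilpotency of [D] means that [L <= [L, D]] with [L <= D] only for [L = 1]. A maximal such [L]
    absorbs its [X]-conjugates, because the join of two such subgroups is another; so it is normal
    in [X]. *)
Lemma nilpotent_normalP (gT : finGroupType) (X D : {group gT}) :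
    D <| X ->
    (forall L : {group gT}, L <| X -> L \subset D -> L \subset [~: L, D] ->
       L :=: 1) ->
  nilpotent D.
Proof.
move=> /andP[sDX nDX] triv; apply/forallP=> L0; apply/implyP.
case/subsetIP=> sL0D sL0; pose ok (L : {set gT}) := (L \subset D) && (L \subset [~: L, D]).
have [|L /maxgroupP[/andP[sLD sL] maxL] sL0L] := @maxgroup_exists _ ok L0.
  by rewrite /ok sL0D.
rewrite -subG1 -(triv L) // /normal (subset_trans sLD sDX) /=.
apply/subsetP=> x Xx; have DxD := normsP nDX x Xx.
have okx : ok (L <*> L :^ x).
  rewrite /ok !join_subG sLD -{1}DxD conjSg sLD /=; apply/andP; split.
    by rewrite (subset_trans sL)// commSg// joing_subl.
  have : L :^ x \subset [~: L, D] :^ x by rewrite conjSg.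
  by rewrite conjsRg DxD => /subset_trans->//; rewrite commSg// joing_subr.
have eqL := maxL (L <*> L :^ x)%G okx (joing_subl _ _).
by rewrite inE -{2}eqL joing_subr.
Qed.

Section ActionOnNilpotent.

Variables (gT : finGroupType) (X F D : {group gT}).
Hypotheses (nFX : F <| X) (nDX : D <| X) (nilF : nilpotent F).
Hypothesis p_action : forall p : nat, exists P : {group gT},
  [/\ p.-group P, P \subset X & D \subset P * 'C('O_p(F))].

(** If [p] divides [#|W|], write [W] as [A \x B] with [A = 'O_p(W)]. The [p]-group [A <*> P] is
    nilpotent, so [[A, D] < A], and [[W, D] <= [A, D] B] is smaller than [W]. *)
Lemma p_action_trivial (W : {group gT}) :
  W <| X -> W \subset F -> W \subset [~: W, D] -> W :=: 1.
Proof.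
move=> nWX sWF sW; apply: contraTeq sW => ntW.
have nilW := nilpotentS sWF nilF.
pose p := pdiv #|W|; have pr_p : prime p by rewrite pdiv_prime ?cardG_gt1.
set A := 'O_p(W); set B := 'O_p^'(W).
have /dprodP[_ defW cAB tiAB] : A \x B = W := nilpotent_pcoreC p nilW.
have nAX : A <| X := gFnormal_trans _ nWX.
have nBX : B <| X := gFnormal_trans _ nWX.
have ntA : A != 1.
  rewrite -cardG_gt1 (card_Hall (nilpotent_pcore_Hall p nilW)) p_part_gt1.
  by rewrite pi_pdiv cardG_gt1.
have sAF : A \subset 'O_p(F).
  apply: pcore_max; first exact: pcore_pgroup.
  apply: normalS nAX; last exact: normal_sub.
  by rewrite (subset_trans _ sWF)// pcore_sub.
have [P [pP sPX sDP]] := p_action p.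
have nAP : P \subset 'N(A) := subset_trans sPX (normal_norm nAX).
have sDX := normal_sub nDX.
have ltA : [~: A, D] \proper A.
  apply: sub_proper_trans (_ : [~: A, P] \proper A).
    rewrite gen_subG; apply/subsetP=> _ /imset2P[a d Aa Dd ->].
    have /mulsgP[x c Px Cc def_d] := subsetP sDP d Dd.
    have Rax : [~ a, x] \in [~: A, P] by rewrite mem_commg.
    have cF y : y \in A -> y ^ c = y.
      move=> Ay; apply/conjg_fixP/commgP/commute_sym.
      by apply: (centP Cc); apply: (subsetP sAF).
    rewrite def_d commgMJ (_ : [~ a, c] = 1) ?mul1g ?cF//; last first.
      exact/eqP/conjg_fixP/cF.
    by rewrite (subsetP _ _ Rax)// commg_subl.
  have nilAP : nilpotent (A <*> P).
    apply: (@pgroup_nil _ p); rewrite /= norm_joinEr// pgroupM pP andbT.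
    exact: pcore_pgroup.
  apply: nil_comm_properl nilAP (joing_subl _ _) ntA _.
  by rewrite subsetI joing_subr.
have sAD := proper_sub ltA.
have cB : B \subset 'C([~: A, D]) by rewrite (subset_trans cAB) ?centS.
apply/negP=> /subset_leq_card; apply/negP; rewrite -ltnNge.
apply: leq_ltn_trans (_ : #|[~: A, D] <*> B| < _).
  rewrite subset_leq_card// gen_subG; apply/subsetP=> _ /imset2P[w d + Dd ->].
  rewrite -defW => /mulsgP[a b Aa Bb ->]; rewrite commMgJ groupM//.
    have Rad : [~ a, d] \in [~: A, D] by rewrite mem_commg.
    rewrite (conjg_fixP _) ?mem_gen ?inE ?Rad//.
    by apply/commgP/commute_sym/(centP (subsetP cB b Bb)).
  rewrite (subsetP (joing_subr _ _))//.
  have : [~: B, D] \subset B by rewrite commg_subl (subset_trans sDX) ?normal_norm.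
  by move/subsetP; apply; rewrite mem_commg.
rewrite cent_joinEr// -{2}defW (TI_cardMg tiAB).
apply: leq_ltn_trans (_ : #|[~: A, D]| * #|B| < _).
  by rewrite mul_cardG leq_pmulr ?cardG_gt0.
by rewrite ltn_pmul2r ?cardG_gt0// proper_card.
Qed.

(** Modulo the centraliser [C] of ['O_p(F)] in [X], [D] lies in the [p]-group [P / C]; there [L <=
    [L, D]] forces [L] to be trivial. The subgroups ['O_p(F)] generate [F]. *)
Lemma p_action_cent (L : {group gT}) :
  L <| X -> L \subset D -> L \subset [~: L, D] -> F \subset 'C(L).
Proof.
move=> nLX sLD sL; rewrite -(nilpotent_Fitting nilF) FittingEgen gen_subG.
apply/bigcupsP=> p _; have [P [pP sPX sDP]] := p_action p.
have nOX : 'O_p(F) <| X := gFnormal_trans _ nFX.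
pose C := 'C_X('O_p(F)).
have nCX : X \subset 'N(C) by rewrite normsI ?normG// norms_cent// normal_norm.
have sLX := normal_sub nLX; have sDX := normal_sub nDX.
have nCP := subset_trans sPX nCX.
have nCL := subset_trans sLX nCX; have nCD := subset_trans sDX nCX.
have sDC : D / C \subset P / C.
  apply/subsetP=> _ /morphimP[d Nd Dd ->].
  have /mulsgP[x c Px Cc def_d] := subsetP sDP d Dd.
  have Xx := subsetP sPX x Px.
  have Cc' : c \in C.
    by rewrite inE Cc -(groupMl _ Xx) -def_d (subsetP sDX).
  have Xc : c \in X by case/setIP: Cc'.
  rewrite def_d morphM ?(subsetP nCX)//= (coset_id Cc') mulg1.
  by rewrite mem_quotient.
suff : L / C \subset [1 coset_of C].
  by rewrite quotient_sub1// subsetI centsC => /andP[_].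
have nilPC : nilpotent (P / C) := quotient_nil _ (pgroup_nil pP).
have /forallP/(_ (L / C)%G)/implyP := nilPC; rewrite subG1; apply.
rewrite subsetI (subset_trans (quotientS _ sLD))//=.
rewrite (subset_trans (quotientS _ sL))// quotientR// commgS//.
Qed.

(* If [L = [L, D]], then [L] centralises [F], so that the three subgroups lemma
   gives [[N, L] = [N, L, D]], whence [[N, L] = 1]; then [L <= N], so that
   [L = [L, D] <= F] and [L = 1]. *)
Lemma nilpotent_of_action (N : {group gT}) :
    N <| X -> [~: N, D] \subset F -> 'C_D(N) \subset N -> nilpotent D.
Proof.
move=> nNX sNDF sCN; apply: nilpotent_normalP nDX _ => L nLX sLD sL.
have cFL := p_action_cent nLX sLD sL.
have sNL : [~: N, L] \subset [~: N, D] by rewrite commgS.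
have normalR (A B : {group gT}) : A <| X -> B <| X -> [~: A, B] <| X.
  move=> /andP[sAX nAX] /andP[sBX nBX].
  by rewrite /normal normsR// comm_subG.
have nRX : [~: N, L] <| X := normalR _ _ nNX nLX.
have sDNF : [~: D, N] \subset F by rewrite commGC.
have R1 : [~: N, L] = 1.
  apply: (p_action_trivial nRX); first exact: subset_trans sNDF.
  (* The three subgroups lemma takes trivial commutators, hence the passage modulo [K]: there
     [[D, N, L]] and [[N, L, D]] vanish, and so does [[L, D, N]], which contains [[N, L]]. *)
  set K := [~: N, L, D]; have nKX : K <| X := normalR _ _ nRX nDX.
  have nK (A : {group gT}) : A <| X -> A \subset 'N(K).
    by move=> nAX; apply: subset_trans (normal_norm nKX); apply: normal_sub.
  have quoR (A B M : {group gT}) : A <| X -> B <| X -> M <| X ->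
      [~: A / K, B / K, M / K] = [~: A, B, M] / K.
    move=> nA nB nM; rewrite -quotientR ?nK// -quotientR ?nK//.
    exact: normalR.
  have := @three_subgroup _ (D / K)%G (N / K)%G (L / K)%G.
  rewrite !quoR// => three; have {three} : [~: L, D, N] / K = 1.
    apply: three; last by rewrite trivg_quotient.
    suff -> : [~: D, N, L] = 1 by rewrite quotient1.
    by apply/commG1P; apply: subset_trans sDNF cFL.
  move=> triv; rewrite /= commGC (subset_trans (commSg N sL))//.
  rewrite -quotient_sub1 ?triv// nK//.
  exact: normalR _ _ (normalR _ _ nLX nDX) nNX.
have sLN : L \subset N.
  by apply: subset_trans sCN; rewrite subsetI sLD centsC; apply/commG1P.
apply: (p_action_trivial nLX) => //.
by rewrite (subset_trans sL)// (subset_trans _ sNDF)// commSg.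
Qed.

End ActionOnNilpotent.

(** * The index of the Fitting subgroup *)

(** The core is the intersection of at most [#|G : H|] conjugates of [H], all of the same index. *)
Lemma index_gcore (gT : finGroupType) (G H : {group gT}) :
  H \subset G -> #|G : gcore H G| <= #|G : H| ^ #|G : H|.
Proof.
move=> sHG; set n := #|G : H|; pose O := orbit 'JG G H.
have leO : #|O| <= n.
  rewrite card_orbit astab1JG dvdn_leq ?indexg_gt0// indexgS//.
  by rewrite subsetI sHG normG.
apply: leq_trans (_ : n ^ #|O| <= _)%N; last by rewrite leq_pexp2l ?indexg_gt0.
apply: leq_trans (_ : #|G : \bigcap_(K in O) (K : {group gT})| <= _).
  rewrite dvdn_leq ?indexg_gt0// indexgS//; apply/bigcapsP=> x Gx.
  by apply: (bigcap_inf (H :^ x)%G); apply/orbitP; exists x.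
apply: (@index_bigcap _ _ (mem O) G id) => _ /orbitP[x Gx <-] /=.
by rewrite -{1}(conjGid Gx) indexJg.
Qed.

Lemma pcore_notin_pi (gT : finGroupType) (G : {group gT}) (p : nat) :
  p \notin \pi(G) -> 'O_p(G) = 1.
Proof.
rewrite -p'groupEpi => p'G; apply/eqP; rewrite trivg_card1; apply/eqP.
exact: pnat_1 (pcore_pgroup p G) (pgroupS (pcore_sub p G) p'G).
Qed.

(** [B] is the preimage of the centraliser of [N / S]; each of the [#|N / S|] elements to be
    centralised has at most [#|N / S|] conjugates. *)
Lemma index_cent_quotient (gT : finGroupType) (X N S : {group gT}) :
    S <| X -> S \subset N -> N <| X ->
  exists B : {group gT}, [/\ B \subset X, [~: N, B] \subset S
    & #|X : B| <= #|N / S| ^ #|N / S|].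
Proof.
move=> nSX' sSN /andP[sNX nNX]; have /andP[sSX nSX] := nSX'.
pose B0 := 'C_(X / S)(N / S); exists (coset S @*^-1 B0)%G.
have sBX : coset S @*^-1 B0 \subset X by rewrite sub_cosetpre_quo ?subsetIl.
split=> //.
  rewrite -quotient_sub1 ?comm_subG ?(subset_trans sNX)// ?(subset_trans sBX)//.
  rewrite quotientR ?(subset_trans sNX)// ?(subset_trans sBX)// cosetpreK.
  by rewrite subG1; apply/eqP/commG1P; rewrite centsC subsetIr.
rewrite -(@index_quotient_eq _ X S)//; last first.
  by rewrite subIset// sub_cosetpre orbT.
rewrite /= cosetpreK; apply: index_cent => y Ny; rewrite index_cent1.
by rewrite subset_leq_card// class_sub_norm// quotient_norms.
Qed.

Lemma nilpotent_central_ext (gT : finGroupType) (M Z : {group gT}) :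
  Z \subset 'Z(M) -> nilpotent (M / Z) -> nilpotent M.
Proof.
rewrite subsetI => /andP[sZM cMZ] nilMZ; apply/forallP=> L; apply/implyP.
case/subsetIP=> sLM sL.
have nZM : M \subset 'N(Z) by rewrite cents_norm// centsC.
have nZL := subset_trans sLM nZM.
have /forallP/(_ (L / Z)%G)/implyP := nilMZ.
rewrite subsetI quotientS//= -quotientR// quotientS// => /(_ isT) trivL.
have sLZ : L \subset Z by rewrite -quotient_sub1// subG1.
rewrite -subG1 (subset_trans sL)// subG1; apply/eqP/commG1P.
exact: subset_trans cMZ.
Qed.

(** For [C = 'C_S('F(S))], ['F(C)] lies in ['F(S)] and so is central in [C]. The preimage of
    ['F(C / 'F(C))] is thus nilpotent and lies in ['F(C)]; the soluble group [C / 'F(C)] has trivial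
    Fitting subgroup, so it is trivial. *)
Lemma cent_Fitting_sub (gT : finGroupType) (S : {group gT}) :
  solvable S -> 'C_S('F(S)) \subset 'F(S).
Proof.
move=> solS; set C := 'C_S('F(S)).
have nCS : C <| S.
  by rewrite /normal subsetIl normsI ?normG// norms_cent// gFnorm.
have sFF : 'F(C) \subset 'F(S).
  by rewrite Fitting_max ?Fitting_nil// gFnormal_trans.
have cFC : C \subset 'C('F(C)) by rewrite (subset_trans (subsetIr _ _)) ?centS.
have nFC : C \subset 'N('F(C)) := gFnorm _ _.
suff /eqP : 'F(C / 'F(C)) = 1.
  rewrite trivg_Fitting ?quotient_sol ?(solvableS (subsetIl _ _))//.
  by rewrite -subG1 quotient_sub1// => /subset_trans->.
pose M := (coset 'F(C) @*^-1 'F(C / 'F(C)))%G.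
have nMC : M <| C.
  by rewrite -[X in _ <| X](quotientGK (Fitting_normal C)) cosetpre_normal gFnormal.
have sFM : 'F(C) \subset M by rewrite sub_cosetpre.
have nilM : nilpotent M.
  apply: (@nilpotent_central_ext _ _ 'F(C)).
    by rewrite subsetI sFM centsC (subset_trans (normal_sub nMC)).
  by rewrite cosetpreK Fitting_nil.
have sMF : M \subset 'F(C) by rewrite Fitting_max.
by rewrite -(cosetpreK 'F(C / 'F(C))) quotientS1.
Qed.

(** [a ^ a] bounds [#|X : B|], the other factor of [d] bounds the index of an intersection of [C.+1]
    subgroups, and [d ^ d] allows for the normal core. The successor keeps the Sylow bound positive
    where the index is [1]. *)
Definition fitting_index_bound k C : nat :=
  let a := fitting_free_bound k C in
  let d := (a ^ a * (coprime_bound k).+1`! ^ C.+1)%N in (d ^ d)%N.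

Section FittingIndex.

Variables (k C : nat) (gT : finGroupType) (X N : {group gT}).
Hypotheses (k0 : 0 < k) (leC : {in \pi(X), forall q, q <= C}).
Hypotheses (nNX : N <| X) (acNX : sylow_almost_commute k N X).

(** For [S] maximal among the soluble subgroups of [N] normalised by [X], the preimage of
    ['F(N / S)] is another, so ['F(N / S) = 1] and [card_fitting_free] applies. *)
Lemma max_solvable_normal : exists S : {group gT},
  [/\ S <| X, S \subset N, solvable S & #|N / S| <= fitting_free_bound k C].
Proof.
have /andP[sNX nNX'] := nNX.
pose ok (S : {set gT}) := [&& S \subset N, X \subset 'N(S) & solvable S].
have [|S /maxgroupP[/and3P[sSN nSX solS] maxS] _] := @maxgroup_exists _ ok 1.
  by rewrite /ok sub1G norms1 solvable1.
have nS : S <| X by rewrite /normal (subset_trans sSN).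
have nSN : S <| N := normalS sSN sNX nS.
exists S; split=> //; apply: card_fitting_free => //.
- have nFX : 'F(N / S) <| X / S by apply: gFnormal_trans; apply: quotient_normal.
  have sF : S \subset coset S @*^-1 'F(N / S) by rewrite sub_cosetpre.
  have eqS : coset S @*^-1 'F(N / S) = S.
    apply: (maxS (coset S @*^-1 'F(N / S))%G) => //.
    rewrite /ok /= sub_cosetpre_quo ?Fitting_sub//=; apply/andP; split.
      by rewrite normal_norm// -[X in _ <| X](quotientGK nS) cosetpre_normal.
    have nSF : S <| coset S @*^-1 'F(N / S).
      rewrite /normal sF (subset_trans _ nSX)// (subset_trans _ sNX)//.
      by rewrite sub_cosetpre_quo ?Fitting_sub.
    by rewrite (series_sol nSF) solS cosetpreK nilpotent_sol ?Fitting_nil.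
  by rewrite -(cosetpreK 'F(N / S)) eqS trivg_quotient.
- move=> q piq; apply: leC; apply: (piSg sNX).
  exact: pi_of_dvd (dvdn_quotient N S) (cardG_gt0 N) q piq.
- apply: sylow_almost_commute_quotient; rewrite ?(subset_trans sNX)//.
  by apply: (sylow_almost_commuteS acNX); rewrite ?normal_refl.
Qed.

Lemma index_Fitting_bounded :
  'C_X(N) \subset N -> #|X : 'F(X)| <= fitting_index_bound k C.
Proof.
move=> sCN; have [S [nSX sSN solS leA]] := max_solvable_normal.
rewrite /fitting_index_bound; set a := fitting_free_bound k C.
set c := (coprime_bound k).+1; set d := (a ^ a * _)%N.
have [B [sBX sNB leB]] := index_cent_quotient nSX sSN nNX.
have sNX := normal_sub nNX; have nNX' := normal_norm nNX.
have sSX := normal_sub nSX.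
pose F := 'F(S)%G.
have nFX : F <| X := gFnormal_trans _ nSX.
have sFN : F \subset N := subset_trans (Fitting_sub S) sSN.
(* [H] is [P 'C_X('O_p(F))] with [P] a Sylow [p]-subgroup of [X]. At a prime [q] other than [p], a
   Sylow [q]-subgroup acts coprimely on ['O_p(F)], so a subgroup of bounded index centralises it. *)
have ex_H (p : 'I_C.+1) : exists H : {group gT},
    [/\ H \subset X, #|X : H| <= c`! & exists P : {group gT},
     [/\ p.-group P, P \subset X & H \subset P * 'C('O_p(F))]].
  have nOX : 'O_p(F) <| X := gFnormal_trans _ nFX.
  have [P sylP] := Sylow_exists p X.
  have nCP : P \subset 'N('C_X('O_p(F))).
    rewrite (subset_trans (pHall_sub sylP))//.
    by rewrite normsI ?normG// norms_cent// normal_norm.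
  have sHX : P <*> 'C_X('O_p(F)) \subset X.
    by rewrite join_subG (pHall_sub sylP) subsetIl.
  exists (P <*> 'C_X('O_p(F)))%G; split=> //; last first.
    exists P; rewrite (pHall_pgroup sylP) (pHall_sub sylP); split=> //=.
    by rewrite norm_joinEl// mulgS// subsetIr.
  apply: index_leq_fact => // q piXq.
  have le1 (Q : {group gT}) : Q \subset P <*> 'C_X('O_p(F)) ->
      #|Q : P <*> 'C_X('O_p(F))| <= c.
    by rewrite -indexg_eq1 => /eqP->.
  have [<- | /eqP neq_pq] := eqVneq (p : nat) q.
    by exists P => //; apply: le1; apply: joing_subl.
  have [piNp | piNp] := boolP ((p : nat) \in \pi(N)); last first.
    have [Q sylQ] := Sylow_exists q X; exists Q => //; apply: le1.
    apply: subset_trans (pHall_sub sylQ) (subset_trans _ (joing_subr _ _)).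
    rewrite pcore_notin_pi ?cent1T ?subsetI ?subxx ?subsetT//.
    by apply: contra piNp; apply: piSg.
  have [P1 sylP1] := Sylow_exists p N.
  have [Q sylQ ac] := sylow_almost_commute_l acNX sNX sylP1 piNp piXq neq_pq.
  exists Q => //.
  have sOP : 'O_p(F) \subset P1.
    apply: subset_trans (pcore_sub_Hall sylP1); apply: pcore_max.
      exact: pcore_pgroup.
    by apply: normalS nOX => //; apply: subset_trans (pcore_sub _ _) _.
  have nOQ : Q \subset 'N('O_p(F)).
    by rewrite (subset_trans (pHall_sub sylQ)) ?normal_norm.
  have acO := almost_commuteSl sOP ac.
  have co : coprime #|'O_p(F)| #|Q|.
    apply: pnat_coprime (pcore_pgroup p F) _.
    apply: sub_in_pnat (pHall_pgroup sylQ) => r _; rewrite !inE => /eqP->.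
    by apply/eqP=> eq_qp; case: neq_pq.
  apply: leq_trans (_ : #|Q : 'C('O_p(F))| <= _).
    rewrite -(indexgI Q 'C(_)) dvdn_leq// indexgS//.
    apply: subset_trans (joing_subr _ _); rewrite setSI// (pHall_sub sylQ)//.
  by rewrite leqW// coprime_almost_commute.
have [H HP] := fin_all_exists ex_H.
pose D0 := (B :&: bigcap_group predT H)%G.
pose D := (gcore D0 X)%G.
have sDX0 : D0 \subset X by rewrite (subset_trans (subsetIl _ _)).
have sDD0 : D \subset D0 := gcore_sub _ _.
have nDX : D <| X by apply: gcore_normal.
have cardC : #|{: 'I_C.+1}| = C.+1 := card_ord _.
have leD0 : #|X : D0| <= d.
  rewrite (leq_trans (index_setI _ _ _))// leq_mul//.
    rewrite (leq_trans leB)// (leq_trans (_ : _ <= a ^ #|N / S|))//.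
      by rewrite leq_exp2r ?cardG_gt0.
    by rewrite leq_pexp2l// (leq_trans _ leA)// cardG_gt0.
  by rewrite -[in leqRHS]cardC; apply: index_bigcap => i _; have [] := HP i.
suff nilD : nilpotent D.
  apply: leq_trans (_ : #|X : D| <= _).
    by rewrite dvdn_leq// indexgS// Fitting_max.
  rewrite (leq_trans (index_gcore sDX0))//.
  apply: leq_trans (_ : d ^ #|X : D0| <= _).
    by rewrite leq_exp2r ?indexg_gt0.
  by rewrite leq_pexp2l// (leq_trans _ leD0)// indexg_gt0.
have p_action (p : nat) : exists P : {group gT},
    [/\ p.-group P, P \subset X & D \subset P * 'C('O_p(F))].
  have [ltpC | gepC] := ltnP p C.+1.
    have [_ _ [P [pP sPX sHP]]] := HP (Ordinal ltpC).
    exists P; split=> //; apply: subset_trans sHP.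
    rewrite (subset_trans sDD0)// (subset_trans (subsetIr _ _))//.
    exact: bigcap_inf.
  exists 1%G; rewrite pgroup1 sub1G mul1g; split=> //.
  rewrite pcore_notin_pi ?cents1//.
  apply/negP=> piFp; have := leC (piSg (subset_trans sFN sNX) piFp).
  by rewrite leqNgt gepC.
have sDB : D \subset B by rewrite (subset_trans sDD0)// subsetIl.
have nilF : nilpotent F := Fitting_nil S.
(* [nilpotent_of_action] is used twice: for [D :&: S] acting on [F], which puts [D :&: S] inside
   [F], and then for [D] acting on [N], as [[N, D] <= D :&: S <= F]. *)
have sDSF : D :&: S \subset F.
  apply: Fitting_max; first by apply: normalS (normalI nDX nSX); rewrite ?subsetIr.
  apply: (@nilpotent_of_action _ X F (D :&: S)%G _ _ nilF _ F) => //.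
  - exact: normalI.
  - move=> p; have [P [pP sPX sDP]] := p_action p; exists P; split=> //.
    by rewrite (subset_trans (subsetIl _ _)).
  - rewrite commg_subl (subset_trans _ (normal_norm nFX))//.
    by rewrite subIset// sSX orbT.
  - apply: subset_trans (cent_Fitting_sub solS).
    by rewrite setSI// subsetIr.
apply: (@nilpotent_of_action _ X F D _ _ nilF _ N) => //.
- apply: subset_trans sDSF; rewrite subsetI commg_subr.
  rewrite (subset_trans sNX) ?(normal_norm nDX)//=.
  by rewrite (subset_trans _ sNB)// commgS.
- by apply: subset_trans sCN; rewrite setSI// normal_sub.
Qed.

End FittingIndex.

(** * The generalised Fitting subgroup *)

Lemma subnormalJ (gT : finGroupType) (G K : {group gT}) x :
  x \in G -> K <|<| G -> K :^ x <|<| G.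
Proof.
move=> Gx snKG; have := morphim_subnormal (conjgm_morphism G x) snKG.
by rewrite !morphim_conj setIid (setIidPr (subnormal_sub snKG)) [G :^ x]conjGid.
Qed.

(** Induction along a subnormal chain: the Fitting subgroup of a normal subgroup [M] lies in that of
    [G]. *)
Lemma subnormal_nilpotent_sub_Fitting (gT : finGroupType) (G K : {group gT}) :
  K <|<| G -> nilpotent K -> K \subset 'F(G).
Proof.
have [n] := ubnP #|G|; elim: n G => // n IH G /ltnSE leGn snKG nilK.
have [<- | [M [snKM nMG ltMG]]] := subnormalEr snKG.
  by rewrite nilpotent_Fitting.
apply: subset_trans (IH M _ snKM nilK) _.
  by rewrite (leq_trans _ leGn)// proper_card.
by rewrite Fitting_max ?Fitting_nil// gFnormal_trans.
Qed.

Lemma cosetpre_subnormal (gT : finGroupType) (Z : {group gT})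
    (A B : {group coset_of Z}) :
  A <|<| B -> coset Z @*^-1 A <|<| coset Z @*^-1 B.
Proof.
have [n] := ubnP #|B|; elim: n B => // n IH B /ltnSE leBn snAB.
have [<- | [M [snAM nMB ltMB]]] := subnormalEr snAB.
  exact: subnormal_refl.
apply: subnormal_trans (IH M _ snAM) _.
  by rewrite (leq_trans _ leBn)// proper_card.
by apply: normal_subnormal; rewrite cosetpre_normal.
Qed.

Lemma quasisimpleJ (gT : finGroupType) (K : {group gT}) x :
  quasisimple K -> quasisimple (K :^ x).
Proof.
case/and3P=> /eqP perfK simK nabK; pose f := conjgm_morphism K x.
have inj : 'injm f by apply: injm_conj.
have imK : f @* K = K :^ x by rewrite morphim_conj setIid.
have iso : K / 'Z(K) \isog (K :^ x) / 'Z(K :^ x).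
  have := sub_isog (subxx (K / 'Z(K))) (injm_quotm (center_normal K) inj).
  by rewrite morphim_quotm injm_center// imK.
rewrite /quasisimple -(isog_simple iso) simK -(isog_abelian iso) nabK.
by rewrite derJ perfK eqxx.
Qed.

Lemma gen_FittingE (gT : finGroupType) (G : {group gT}) :
  gen_Fitting G :=:
    'F(G) <*> <<\bigcup_(K : {group gT} | subnormal K G && quasisimple K) K>>.
Proof. by rewrite /gen_Fitting /= bigprodGE. Qed.

Lemma Fitting_sub_gen (gT : finGroupType) (G : {group gT}) :
  'F(G) \subset gen_Fitting G.
Proof. by rewrite gen_FittingE joing_subl. Qed.

Lemma component_sub_gen_Fitting (gT : finGroupType) (G K : {group gT}) :
  K <|<| G -> quasisimple K -> K \subset gen_Fitting G.
Proof.
move=> snK qK; rewrite gen_FittingE.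
apply: subset_trans (subset_trans (subset_gen _) (joing_subr _ _)).
by apply: (bigcup_max K) => //; rewrite snK.
Qed.

Lemma gen_Fitting_normal (gT : finGroupType) (G : {group gT}) :
  gen_Fitting G <| G.
Proof.
rewrite /normal gen_FittingE join_subG gFsub gen_subG /=; apply/andP; split.
  by apply/bigcupsP=> K /andP[snK _]; apply: subnormal_sub.
rewrite normsY ?gFnorm// norms_gen//; apply/subsetP=> x Gx; rewrite inE.
apply/subsetP=> _ /imsetP[y /bigcupP[K /andP[snK qK] Ky] ->].
apply/bigcupP; exists (K :^ x)%G; last by rewrite memJ_conjg.
by rewrite subnormalJ ?quasisimpleJ.
Qed.

(* Otherwise [C := 'C_G(gen_Fitting G)] has a subnormal subgroup [S] with
   [S / (C :&: gen_Fitting G)] simple. It is a central extension of that simple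
   group, so that [S] is nilpotent or [S^`(1)] is quasisimple. *)
Lemma cent_gen_Fitting_sub (gT : finGroupType) (G : {group gT}) :
  'C_G(gen_Fitting G) \subset gen_Fitting G.
Proof.
set Fs := gen_Fitting G; have nFG : Fs <| G := gen_Fitting_normal G.
pose C := 'C_G(Fs)%G; pose Z := (C :&: Fs)%G.
have nCG : C <| G.
  by rewrite /normal subsetIl normsI ?normG// norms_cent// normal_norm.
have nZC : Z <| C.
  rewrite /normal subsetIl normsI ?normG//.
  by rewrite (subset_trans (normal_sub nCG)) ?normal_norm.
have [sCZ | ntCZ] := eqVneq (C / Z) 1.
  have : C \subset Z by rewrite -quotient_sub1 ?normal_norm// sCZ.
  by rewrite subsetI => /andP[].
pose ok (A : {set coset_of Z}) := (A != 1) && subnormal A (C / Z).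
have [|S0 /mingroupP[/andP[ntS0 snS0] minS0] _] := @mingroup_exists _ ok (C / Z)%G.
  by rewrite /ok ntCZ subnormal_refl.
have simS0 : simple S0.
  apply/simpleP; split=> // H nHS0; have [-> | ntH] := eqVneq H 1%G; first by left.
  right; apply: minS0; last exact: normal_sub.
  by rewrite /ok ntH (subnormal_trans (normal_subnormal nHS0)).
pose S := (coset Z @*^-1 S0)%G.
have defS0 : S / Z = S0 := cosetpreK _.
have sZS : Z \subset S := sub_cosetpre _.
have snSC : S <|<| C by rewrite -[X in _ <|<| X](quotientGK nZC) cosetpre_subnormal.
have sSC := subnormal_sub snSC.
have snSG : S <|<| G := subnormal_trans snSC (normal_subnormal nCG).
have cZS : S \subset 'C(Z).
  by rewrite (subset_trans sSC)// (subset_trans (subsetIr _ _))// centS// subsetIr.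
have notSZ : ~~ (S \subset Z).
  by apply: contra ntS0 => /quotientS1 S1; rewrite -defS0 S1.
case: (negP notSZ).
have sub_Z (K : {group gT}) : K \subset S -> K \subset Fs -> K \subset Z.
  by move=> sKS sKF; rewrite subsetI (subset_trans sKS).
have [abS0 | nabS0] := boolP (abelian S0).
  apply: sub_Z => //; apply: subset_trans (Fitting_sub_gen G).
  apply: subnormal_nilpotent_sub_Fitting => //.
  apply: (@nilpotent_central_ext _ _ Z); first by rewrite subsetI sZS centsC.
  by rewrite defS0 abelian_nil.
have nZS : S \subset 'N(Z) := subset_trans sSC (normal_norm nZC).
pose K := S^`(1)%G; have sKS : K \subset S := der_sub 1 S.
have [_ minS] := simpleP _ simS0.
have perfS0 : S0^`(1) = S0.
  have [/eqP|//] := minS S0^`(1)%G (der_normal 1 S0).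
  by rewrite -[_ == _]/(S0^`(1)%G :==: 1) => /eqP/derG1P; rewrite (negPf nabS0).
have defKZ : K / Z = S0 by rewrite /= quotient_der// defS0.
have sSZK : S \subset Z * K.
  by rewrite -quotientK ?(subset_trans sKS)// defKZ.
have cZ z s : z \in Z -> s \in S -> [~ z, s] = 1.
  by move=> Zz Ss; apply/eqP/commgP/commute_sym/(centP (subsetP cZS s Ss)).
(* Since [S = Z * K] with [Z] central in [S], every commutator of elements of [S] is a commutator of
   elements of [K]. *)
have perfK : K^`(1) == K.
  rewrite eqEsubset der_sub andTb; have defK : K = [~: S, S] :> {set gT} by [].
  rewrite [in X in X \subset _]defK gen_subG.
  apply/subsetP=> _ /imset2P[s t Ss St ->].
  have /mulsgP[z k Zz Kk def_s] := subsetP sSZK s Ss.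
  have /mulsgP[y l Zy Kl def_t] := subsetP sSZK t St.
  have Sk := subsetP sKS k Kk.
  rewrite def_s commMgJ cZ// conj1g mul1g def_t commgMJ.
  have -> : [~ k, y] = 1 by rewrite -invg_comm cZ ?invg1.
  by rewrite conj1g mulg1 mem_commg.
have defZK : 'Z(K) = Z :&: K.
  apply/eqP; rewrite eqEsubset; apply/andP; split; last first.
    rewrite subsetI subsetIr (subset_trans (subsetIl _ _))//.
    by rewrite centsC (subset_trans sKS).
  rewrite subsetI center_sub andbT.
  have nZKS : 'Z(K) <| S by rewrite !gFnormal_trans.
  have [||] := minS ('Z(K) / Z)%G.
  - by rewrite -defS0 quotient_normal.
  - by move=> triv; rewrite -quotient_sub1 ?triv// (subset_trans (normal_sub nZKS)).
  by move=> eqS0; case/negP: nabS0; rewrite -eqS0 quotient_abelian ?center_abelian.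
have isoK : K / 'Z(K) \isog S0.
  by rewrite defZK -defKZ second_isog// (subset_trans sKS).
have qK : quasisimple K.
  by rewrite /quasisimple perfK (isog_simple isoK) simS0 (isog_abelian isoK).
have sKZ : K \subset Z.
  apply: sub_Z => //; apply: component_sub_gen_Fitting => //.
  exact: subnormal_trans (normal_subnormal (der_normal 1 S)) snSG.
by rewrite (subset_trans sSZK)// mul_subG.
Qed.

(** * The second Fitting subgroup *)

(** The number of Sylow [q]-subgroups of [T Q] is [1] modulo [q] and below [q], hence [1]. Its bound
    is obtained prime by prime: for [p] other than [q], a Sylow [p]-subgroup of [T] is one of [T Q],
    and a subgroup of index at most [2 * k] in it centralises [Q]. *)
Lemma large_Sylow_normalised k (gT : finGroupType) (G T Q : {group gT})
    (q : nat) :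
    0 < k -> T <| G -> sylow_almost_commute k T G -> q \in \pi(G) ->
    q.-Sylow(G) Q -> (2 * k)`! < q ->
  T \subset 'N(Q).
Proof.
move=> k0 nTG acTG piGq sylQ ltq.
have [sTG nTG'] := andP nTG; have sQG := pHall_sub sylQ.
have pr_q : prime q by move: piGq; rewrite mem_primes => /and3P[].
have qQ := pHall_pgroup sylQ.
have lt2k : 2 * k < q by apply: leq_ltn_trans ltq; apply: fact_geq.
pose M := (T <*> Q)%G; have nTQ : Q \subset 'N(T) by rewrite (subset_trans sQG).
have defM : M :=: T * Q by rewrite /= norm_joinEr.
have sMG : M \subset G by rewrite join_subG sTG.
have sQM : Q \subset M := joing_subr _ _.
have sTM : T \subset M := joing_subl _ _.
have sylQM := pHall_subl sQM sMG sylQ.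
suff le : #|M : 'N_M(Q)| <= (2 * k)`!.
  apply: subset_trans sTM _.
  have := card_Syl_mod M pr_q; rewrite (card_Syl sylQM) modn_small ?(leq_ltn_trans le)//.
  by move/eqP; rewrite indexg_eq1 subsetI => /andP[].
apply: index_leq_fact => [|p piMp]; first exact: subsetIl.
have [-> | neq_pq] := eqVneq p q.
  exists Q => //; rewrite (_ : #|_ : _| = 1%N) ?muln_gt0//.
  by apply/eqP; rewrite indexg_eq1 subsetI sQM normG.
have piTp : p \in \pi(T).
  move: piMp; rewrite !mem_primes !cardG_gt0 => /and3P[pr_p _ p_dv].
  rewrite pr_p /=; have : p %| #|T| * #|Q|.
    by rewrite (dvdn_trans p_dv)// defM mul_cardG dvdn_mulr.
  rewrite Euclid_dvdM// => /orP[//|p_dvQ].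
  have := pgroupP qQ p pr_p p_dvQ; rewrite inE => /eqP eq_pq.
  by rewrite eq_pq eqxx in neq_pq.
have [P sylP ac] := sylow_almost_commute_r acTG nTG sylQ piTp piGq (elimN eqP neq_pq).
have sPM := subset_trans (pHall_sub sylP) sTM.
exists P.
  rewrite pHallE sPM (card_Hall sylP) -(Lagrange sTM) partnM//.
  rewrite (part_p'nat (_ : p^'.-nat #|M : T|)) ?muln1 ?eqxx//.
  have nTM : M \subset 'N(T) by rewrite join_subG normG.
  rewrite -card_quotient// (_ : M / T = Q / T); last by rewrite defM quotientMidl.
  by apply: pi_p'nat (quotient_pgroup T qQ) _; rewrite !inE neq_pq.
rewrite almost_commuteC in ac.
apply: leq_trans (large_prime_almost_commute qQ lt2k ac).
rewrite -(indexgI P 'C(Q)) dvdn_leq// indexgS//.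
by rewrite setISS// cent_sub.
Qed.

(** Modulo [gen_Fitting G], which contains ['F(G)], [Y] centralises a generalised Fitting subgroup
    and so lies in it. *)
Lemma cent_mod_Fitting (gT : finGroupType) (G Y : {group gT}) :
  Y \subset G -> [~: gen_Fitting2 G, Y] \subset 'F(G) -> Y \subset gen_Fitting2 G.
Proof.
move=> sYG sTYF; have nFG := gen_Fitting_normal G.
have nG := normal_norm nFG.
have sTG : gen_Fitting2 G \subset G.
  by rewrite sub_cosetpre_quo// normal_sub// gen_Fitting_normal.
rewrite -sub_quotient_pre ?(subset_trans sYG)//.
apply: subset_trans (cent_gen_Fitting_sub _); rewrite subsetI quotientS//= centsC.
apply/commG1P; rewrite -[X in [~: X, _]](cosetpreK (gen_Fitting _)).
rewrite -quotientR ?(subset_trans sYG)// ?(subset_trans sTG)//.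
exact: quotientS1 (subset_trans sTYF (Fitting_sub_gen G)).
Qed.

Lemma index_Fitting2_bounded k (gT : finGroupType) (G T : {group gT}) :
    0 < k -> T = gen_Fitting2 G -> sylow_almost_commute k T G ->
  #|G : Fitting2 G| <= fitting_index_bound k (2 * k)`!.
Proof.
move=> k0 defT acTG; have nFG := Fitting_normal G; have nG := normal_norm nFG.
have nFs := gen_Fitting_normal G.
have nTG : T <| G.
  by rewrite defT -[X in _ <| X](quotientGK nFs) cosetpre_normal gen_Fitting_normal.
have [sTG nTG'] := andP nTG.
have sFsT : gen_Fitting G \subset T by rewrite defT sub_cosetpre.
have sFT : 'F(G) \subset T := subset_trans (Fitting_sub_gen G) sFsT.
have nil_sub (A : {group gT}) : A <| T -> nilpotent A -> A \subset 'F(G).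
  move=> nAT nilA; apply: subset_trans (Fitting_max nAT nilA) _.
  by rewrite Fitting_max ?Fitting_nil// gFnormal_trans.
have leC : {in \pi(G / 'F(G)), forall q, q <= (2 * k)`!}.
  move=> q piq; rewrite leqNgt; apply/negP=> ltq.
  have piGq : q \in \pi(G).
    exact: pi_of_dvd (dvdn_quotient _ _) (cardG_gt0 G) q piq.
  have [Q sylQ] := Sylow_exists q G.
  have sQG := pHall_sub sylQ; have qQ := pHall_pgroup sylQ.
  have nQT := large_Sylow_normalised k0 nTG acTG piGq sylQ ltq.
  (* [T] normalises [Q], so [T :&: Q] is a normal [q]-subgroup of [T]; it contains [[T, Q]]. *)
  have sTQ : T :&: Q \subset 'F(G).
    apply: nil_sub; first by rewrite /normal subsetIl normsI ?normG.
    exact: pgroup_nil (pgroupS (subsetIr _ _) qQ).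
  have sQT : Q \subset T.
    rewrite defT cent_mod_Fitting// -defT (subset_trans _ sTQ)//.
    by rewrite subsetI commg_subl commg_subr nQT (subset_trans sQG).
  have sQF : Q \subset 'F(G) by rewrite -(setIidPr sQT).
  have sylQF : q.-Sylow(G / 'F(G)) (Q / 'F(G)).
    exact: quotient_pHall (subset_trans sQG nG) sylQ.
  have := card_Hall sylQF; rewrite /= (quotientS1 sQF) cards1 => /esym part1.
  by move: piq; rewrite -p_part_gt1 part1.
have sNG : 'C_(G / 'F(G))(T / 'F(G)) \subset T / 'F(G).
  rewrite -(cosetpreK 'C_(G / 'F(G))(T / 'F(G))) quotientS//.
  have sY : coset 'F(G) @*^-1 'C_(G / 'F(G))(T / 'F(G)) \subset G.
    by rewrite sub_cosetpre_quo// subsetIl.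
  rewrite {2}defT cent_mod_Fitting// -defT.
  have nY := subset_trans sY nG; have nT := subset_trans sTG nG.
  rewrite -quotient_sub1 ?comm_subG// quotientR// cosetpreK.
  by rewrite subG1; apply/eqP/commG1P; rewrite centsC subsetIr.
have := index_Fitting_bounded k0 leC (quotient_normal _ nTG)
  (sylow_almost_commute_quotient acTG (subset_trans sTG nG) nG) sNG.
by rewrite -(index_cosetpre (G / 'F(G)) 'F(G / 'F(G))) quotientGK.
Qed.

Theorem theorem1p5 (R : realType) (eps : R) (eps_gt0 : (0 < eps)%R) :
  exists N : nat, forall (gT : finGroupType) (G T : {group gT}),
    T = gen_Fitting2 G -> comm_prob_star_ge T G eps ->
    (#|G : Fitting2 G|%g <= N)%N.
Proof.
have Veps_gt0 : (0 < eps^-1)%R by rewrite Num.Theory.invr_gt0.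
pose k := Num.bound eps^-1%R.
have ltk : (eps^-1 < k%:R)%R.
  by rewrite Num.Theory.archi_boundP ?Order.POrderTheory.ltW.
have k0 : (0 < k)%N.
  by rewrite -(Num.Theory.ltr_nat R) (Order.POrderTheory.lt_trans Veps_gt0).
exists (fitting_index_bound k (2 * k)`!) => gT G T defT starTG.
apply: index_Fitting2_bounded defT _ => // p q piTp piGq neq_pq.
have [P [Q [sylP sylQ le_eps]]] := starTG p q piTp piGq neq_pq.
rewrite !inE in sylP sylQ; exists P, Q; split=> //.
rewrite /almost_commute -(Num.Theory.ler_nat R) !GRing.natrM.
move: le_eps; rewrite /comm_prob Num.Theory.ler_pdivlMr; last first.
  by rewrite Num.Theory.mulr_gt0// Num.Theory.ltr0n cardG_gt0.
rewrite -Num.Theory.ler_pdivlMl// => /Order.POrderTheory.le_trans; apply.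
by rewrite Num.Theory.ler_wpM2r ?Num.Theory.ler0n// Order.POrderTheory.ltW.
Qed.
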